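(* Let $f : T' \to T$ be the morphism of tori given by $$X_1 = (Y_2Y_3Y_4Y_5)^{-1},\quad X_2 = Y_2Y_5,\quad X_3 = Y_3,\quad X_4 = (Y_1Y_3Y_4Y_5)^{-1}.$$ After setting $b_4 = a_5$, the families $\mathcal{X}^*_{BB}$ and $\mathcal{X}^*_{C}$ are birationally equivalent via $f$. That is, $f\times \mathrm{id}_{\mathbb{C}} : T'\times\mathbb{C}\to T\times\mathbb{C}$ maps $\mathcal{X}^*_{BB}$ into $\mathcal{X}^*_C$ compatibly with the projections to $\mathbb{C}$, and for each common value of the parameter $b_4=a_5$ the map $f$ restricts to a birational morphism from the corresponding member of $\mathcal{X}^*_{BB}$ to the corresponding member of $\mathcal{X}^*_C$.
   Context: Work over $\mathbb{C}$. Let $M = \mathbb{Z}^4$ with standard basis $f_1,\dots,f_4$ and $M' = \mathbb{Z}^5$ with standard basis $e_1,\dots,e_5$. Let $T = \mathrm{Spec}\,\mathbb{C}[M]$ and $T' = \mathrm{Spec}\,\mathbb{C}[M']$ be the corresponding tori, with coordinates $X_i = z^{f_i}$ ($1\le i\le 4$) on $T$ and $Y_i = z^{e_i}$ ($1\le i\le 5$) on $T'$ (so $T\cong(\mathbb{C}^* )^4$, $T'\cong(\mathbb{C}^* )^5$). The family $\mathcal{X}^*_C\subseteq T\times\mathbb{C}$, with parameter $a_5\in\mathbb{C}$, is the family of hypersurfaces in $T$ defined by $$-1+X_1+X_2+X_3+X_4+a_5(X_1X_2X_3)^{-1}+X_1X_2X_4^{-1}=0.$$ The family $\mathcal{X}^*_{BB}\subseteq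 T'\times\mathbb{C}$, with parameter $b_4\in\mathbb{C}$, is the family of subvarieties of $T'$ defined by $$Y_1+Y_2+Y_3+b_4Y_4=1,\qquad Y_5+(Y_1Y_2Y_3Y_4Y_5)^{-1}=1.$$ A member of a family is the fiber over a given value of the parameter. A morphism is birational if it restricts to an isomorphism between dense open subsets. *)

(* Defs.v *)
From mathcomp Require Import all_boot all_order all_algebra.
From mathcomp Require Import complex.
From mathcomp Require Import mpoly.
From mathcomp Require Import classical_sets reals.

Set Implicit Arguments.
Unset Strict Implicit.
Unset Printing Implicit Defensive.

Import GRing.Theory.
Local Open Scope classical_set_scope.
Local Open Scope ring_scope.

(* Varieties are classical ones: a variety is the set of its closed points, a
   locally closed subset of an affine space F^n = 'rV[F]_n over an
   algebraically closed field F.  The torus (F^* )^n sits in F^n as the open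
   set where all coordinates are nonzero; its Zariski topology is the induced
   one, because a Laurent polynomial becomes a polynomial after multiplication
   by a monomial, which vanishes nowhere on the torus. *)

Section Zariski.
Context {F : closedFieldType}.

Definition zariski_closed n (Z : set 'rV[F]_n) : Prop :=
  exists E : set {mpoly F[n]}, Z = [set x | forall p, E p -> p.@[x 0] = 0].

Definition open_in n (X U : set 'rV[F]_n) : Prop :=
  exists2 Z, zariski_closed Z & U = X `\` Z.

Definition dense_in n (X U : set 'rV[F]_n) : Prop :=
  forall O, open_in X O -> O !=set0 -> O `&` U !=set0.

Definition regular_function n (X : set 'rV[F]_n) (phi : 'rV[F]_n -> F) : Prop :=
  forall x, X x -> exists U, [/\ open_in X U, U x &
    exists p q : {mpoly F[n]},
      forall y, U y -> q.@[y 0] != 0 /\ phi y = p.@[y 0] / q.@[y 0]].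

(* Only the values of g on X matter. *)
Definition morphism n m (X : set 'rV[F]_n) (Y : set 'rV[F]_m)
    (g : 'rV[F]_n -> 'rV[F]_m) : Prop :=
  (forall x, X x -> Y (g x)) /\
  (forall j, regular_function X (fun x => g x 0 j)).

Definition isomorphism n m (X : set 'rV[F]_n) (Y : set 'rV[F]_m)
    (g : 'rV[F]_n -> 'rV[F]_m) : Prop :=
  morphism X Y g /\
  exists h, [/\ morphism Y X h,
                forall x, X x -> h (g x) = x &
                forall y, Y y -> g (h y) = y].

Definition birational_morphism n m (X : set 'rV[F]_n) (Y : set 'rV[F]_m)
    (g : 'rV[F]_n -> 'rV[F]_m) : Prop :=
  morphism X Y g /\
  exists U V, [/\ open_in X U, dense_in X U, open_in Y V, dense_in Y V &
                  isomorphism U V g].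

End Zariski.

Section Families.
Context {F : closedFieldType}.

Definition torus n : set 'rV[F]_n := [set x | forall i, x 0 i != 0].

(* The product of A with the affine line; the parameter is the last coordinate
   of a point of F^(n + 1). *)
Definition times_line n (A : set 'rV[F]_n) : set 'rV[F]_(n + 1) :=
  [set z | A (lsubmx z)].

Definition param n (z : 'rV[F]_(n + 1)) : F := rsubmx z 0 0.

Definition times_id n m (g : 'rV[F]_n -> 'rV[F]_m) (z : 'rV[F]_(n + 1)) :
    'rV[F]_(m + 1) :=
  row_mx (g (lsubmx z)) (rsubmx z).

Definition member n (X : set 'rV[F]_(n + 1)) (a : F) : set 'rV[F]_n :=
  [set x | X (row_mx x a%:M)].

(* Coordinates numbered from 1; only used with 1 <= i <= n.+1. *)
Definition coord1 n (x : 'rV[F]_n.+1) (i : nat) : F := x 0 (inord i.-1).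

Definition family_C : set 'rV[F]_(4 + 1) :=
  [set z | times_line (@torus 4) z /\
    let x := lsubmx z in
    let X1 := coord1 x 1 in let X2 := coord1 x 2 in
    let X3 := coord1 x 3 in let X4 := coord1 x 4 in
    let a5 := param z in
    - 1 + X1 + X2 + X3 + X4 + a5 * (X1 * X2 * X3)^-1 + X1 * X2 * X4^-1 = 0].

Definition family_BB : set 'rV[F]_(5 + 1) :=
  [set z | times_line (@torus 5) z /\
    let y := lsubmx z in
    let Y1 := coord1 y 1 in let Y2 := coord1 y 2 in
    let Y3 := coord1 y 3 in let Y4 := coord1 y 4 in
    let Y5 := coord1 y 5 in
    let b4 := param z in
    Y1 + Y2 + Y3 + b4 * Y4 = 1 /\
    Y5 + (Y1 * Y2 * Y3 * Y4 * Y5)^-1 = 1].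

Definition torus_map (y : 'rV[F]_5) : 'rV[F]_4 :=
  let Y1 := coord1 y 1 in let Y2 := coord1 y 2 in
  let Y3 := coord1 y 3 in let Y4 := coord1 y 4 in
  let Y5 := coord1 y 5 in
  \row_(j < 4) [:: (Y2 * Y3 * Y4 * Y5)^-1;
                   Y2 * Y5;
                   Y3;
                   (Y1 * Y3 * Y4 * Y5)^-1]`_j.

End Families.

(* Main.v *)
Require Import Defs.
From mathcomp Require Import all_boot all_order all_algebra.
From mathcomp Require Import complex.
From mathcomp Require Import mpoly.
From mathcomp Require Import classical_sets reals.
From mathcomp Require Import boolp ring.

Set Implicit Arguments.
Unset Strict Implicit.
Unset Printing Implicit Defensive.

Import GRing.Theory.
Local Open Scope classical_set_scope.
Local Open Scope ring_scope.

(** On the locus Y5 + 1/(Y1 Y2 Y3 Y4 Y5) = 1 the coordinates of the torus map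
    satisfy
      X1 = Y1 (1 - Y5),   X1 X2 / X4 = Y1 Y5,
      X4 = Y2 (1 - Y5),   X2 = Y2 Y5,
      X3 = Y3,            1 / (X1 X2 X3) = Y4,
    so that X1 + X1 X2 / X4 = Y1 and X2 + X4 = Y2: the equation of the second
    family pulls back to Y1 + Y2 + Y3 + b4 Y4 = 1.  The same formulas show how
    to invert the map wherever X2 + X4 does not vanish: Y2 = X2 + X4,
    Y5 = X2 / (X2 + X4), and so on.  Hence the torus map is an isomorphism from
    the whole member of the first family onto the open part [C_open] of the
    member of the second one where X2 + X4 <> 0 ([torus_map_isomorphism]).

    It remains to see that [C_open] is dense for every value of the parameter,
    including those for which the member is singular; this is [vanish_on_C]: a
    polynomial p that vanishes on [C_open] vanishes at each point x of the
    member with x2 + x4 = 0.  Freeze the coordinates X1 = x1 and X4 = x4; in the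
    remaining variables t = X2 and z = X3 the equation of the member becomes a
    quadratic equation
      t z^2 - t (1 - (t + x4) (1 + x1 / x4)) z + a / x1 = 0
    for z over F(t), and X2 + X4 <> 0 means t <> x2.  So x lies on a double
    cover of the t-line all of whose fibres, apart from finitely many, consist
    of zeros of p (times X3, which takes care of solutions with z = 0).  The
    trace and the norm of p along this double cover are then zero for almost
    all t, hence for t = x2 too; two numbers with zero sum and zero product
    both vanish, and the value at x is one of them ([vanish_at_quadratic_limit]).  Trace
    and norm allow a uniform argument: the cover may be reducible or
    ramified at x, and a may be 0. *)

(** * Functions that are quotients of polynomials *)

Section RegularQuotients.
Context {F : closedFieldType}.

(** Regularity asks for a presentation as a fraction near each point only; all
    the functions met below have a single fraction valid on the whole of X, and
    this global form is stable under the field operations without shrinking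
    neighbourhoods. *)
Definition quotient_on n (X : set 'rV[F]_n) (phi : 'rV[F]_n -> F) : Prop :=
  exists p q : {mpoly F[n]},
    forall y, X y -> q.@[y 0] != 0 /\ phi y = p.@[y 0] / q.@[y 0].

Context (n : nat) (X : set 'rV[F]_n).
Implicit Types phi psi : 'rV[F]_n -> F.

(* The empty set is the zero locus of all polynomials, 1 among them. *)
Lemma open_in_self : open_in X X.
Proof.
exists set0; last by rewrite setD0.
exists setT; apply/seteqP; split=> x //= /(_ 1 I) /eqP.
by rewrite meval1 oner_eq0.
Qed.

Lemma quotient_on_regular phi : quotient_on X phi -> regular_function X phi.
Proof. by move=> phiP x Xx; exists X; split=> //; exact: open_in_self. Qed.

Lemma eq_quotient_on phi psi :
  (forall y, X y -> phi y = psi y) -> quotient_on X phi -> quotient_on X psi.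
Proof.
move=> e [p [q pq]]; exists p, q => y Xy; rewrite -e //; exact: pq.
Qed.

Lemma quotient_on_coord i : quotient_on X (fun y => y 0 i).
Proof.
by exists 'X_i, 1 => y _; rewrite meval1 mevalXU divr1 oner_neq0.
Qed.

Lemma quotient_onD phi psi :
  quotient_on X phi -> quotient_on X psi ->
  quotient_on X (fun y => phi y + psi y).
Proof.
move=> [p1 [q1 h1]] [p2 [q2 h2]]; exists (p1 * q2 + p2 * q1), (q1 * q2) => y Xy.
have [[n1 ->] [n2 ->]] := (h1 y Xy, h2 y Xy).
by rewrite mevalD !mevalM mulf_neq0 // addf_div.
Qed.

Lemma quotient_onM phi psi :
  quotient_on X phi -> quotient_on X psi ->
  quotient_on X (fun y => phi y * psi y).
Proof.
move=> [p1 [q1 h1]] [p2 [q2 h2]]; exists (p1 * p2), (q1 * q2) => y Xy.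
have [[n1 ->] [n2 ->]] := (h1 y Xy, h2 y Xy).
by rewrite !mevalM mulf_neq0 // mulf_div.
Qed.

Lemma quotient_onV phi :
  (forall y, X y -> phi y != 0) -> quotient_on X phi ->
  quotient_on X (fun y => (phi y)^-1).
Proof.
move=> phi0 [p [q h]]; exists q, p => y Xy.
have [n1 e] := h y Xy; split; last by rewrite e invf_div.
by apply: contraNneq (phi0 y Xy) => p0; rewrite e p0 mul0r.
Qed.

End RegularQuotients.

(** * Polynomials vanishing on almost all fibres of a double cover *)

Section Quadratic.
Context {F : closedFieldType}.
Implicit Types (P Q : {poly {poly F}}) (t z : F).

Lemma poly_eq0_cofinite (p d : {poly F}) :
  d != 0 -> (forall t, d.[t] != 0 -> p.[t] = 0) -> p = 0.
Proof.
move=> d0 h; apply/eqP; apply: contraT => p0.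
have /closed_nonrootP[t] : d * p != 0 by rewrite mulf_neq0.
rewrite rootM negb_or => /andP[/h pt]; by rewrite rootE pt eqxx.
Qed.

Lemma quadratic_split (l m c : F) :
  l != 0 -> exists z1 z2, l * (z1 + z2) = - m /\ l * (z1 * z2) = c.
Proof.
move=> l0.
have [z1] := solve_monicpoly (fun i => if i == 0%N then - c / l else - m / l)
  (ltn0Sn 1).
rewrite big_ord_recl big_ord1 /= expr0 expr1 mulr1 => e.
have {}e : l * z1 ^+ 2 = - c - m * z1 by rewrite e; field.
exists z1, (- m / l - z1); split; first by field.
have -> : l * (z1 * (- m / l - z1)) = - m * z1 - l * z1 ^+ 2 by field.
by rewrite e; ring.
Qed.

(** Let the curve l z^2 + m z + c = 0 cover the t-line two to one where l does
    not vanish.  If P vanishes on the fibres over almost all t, it vanishes on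
    the fibre over t0, even at a point lying on a single component of the curve
    or at a branch point: the trace and the norm of P are polynomials in t up to
    a power of l, so they vanish at t0, and the two values of P above t0 have
    zero sum and zero product. *)
Lemma vanish_at_quadratic_limit (l m c : {poly F}) P t0 z0 :
  l.[t0] != 0 ->
  (forall t z, t != t0 -> l.[t] != 0 ->
     l.[t] * z ^+ 2 + m.[t] * z + c.[t] = 0 -> P.[z, t] = 0) ->
  l.[t0] * z0 ^+ 2 + m.[t0] * z0 + c.[t0] = 0 -> P.[z0, t0] = 0.
Proof.
move=> lt0 vanish root0.
have l0 : l != 0 by apply: contraNneq lt0 => ->; rewrite horner0.
(* Pseudo-division by the equation of the curve makes P affine in z. *)
pose Q : {poly {poly F}} := Poly [:: c; m; l].
have polyQ : polyseq Q = [:: c; m; l] by rewrite (@PolyK _ 0).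
have Q_neq0 : Q != 0 by rewrite -size_poly_eq0 polyQ.
have rem_small : (size (P %% Q)%R <= 2)%N.
  by have := ltn_modpN0 P Q_neq0; rewrite polyQ.
pose al := (P %% Q)%R`_0; pose be := (P %% Q)%R`_1; pose k := scalp P Q.
have red t z : l.[t] * z ^+ 2 + m.[t] * z + c.[t] = 0 ->
    l.[t] ^+ k * P.[z, t] = al.[t] + be.[t] * z.
  move=> root_tz.
  have := congr1 (fun p : {poly {poly F}} => p.[z, t])
    (Pdiv.Idomain.divp_eq P Q).
  have -> : lead_coef Q = l by rewrite lead_coefE polyQ.
  rewrite hornerD !hornerM hornerZ.
  have -> : (P %% Q).[z%:P] = al + be * z%:P.
    by rewrite (horner_coef_wide _ rem_small) big_ord_recl big_ord1 /= mulr1.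
  have -> : Q.[z%:P] = l * z%:P ^+ 2 + m * z%:P + c.
    by rewrite horner_Poly /=; ring.
  have Qtz : (l * z%:P ^+ 2 + m * z%:P + c).[t] = 0.
    by rewrite -root_tz !hornerE.
  by rewrite hornerD !hornerM Qtz mulr0 add0r horner_exp !hornerE.
(* Up to a factor l, the trace and the norm of the remainder al + be z. *)
pose trace := 2%:R * al * l - be * m.
pose norm := al ^+ 2 * l - al * be * m + be ^+ 2 * c.
have trE t z1 z2 : l.[t] * (z1 + z2) = - m.[t] ->
    l.[t] * ((al.[t] + be.[t] * z1) + (al.[t] + be.[t] * z2)) = trace.[t].
  move=> e.
  transitivity (2%:R * al.[t] * l.[t] + be.[t] * (l.[t] * (z1 + z2))).
    by ring.
  by rewrite e /trace !hornerE; ring.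
have noE t z1 z2 : l.[t] * (z1 + z2) = - m.[t] -> l.[t] * (z1 * z2) = c.[t] ->
    l.[t] * ((al.[t] + be.[t] * z1) * (al.[t] + be.[t] * z2)) = norm.[t].
  move=> e1 e2.
  transitivity (al.[t] ^+ 2 * l.[t] + al.[t] * be.[t] * (l.[t] * (z1 + z2))
    + be.[t] ^+ 2 * (l.[t] * (z1 * z2))); first by ring.
  by rewrite e1 e2 /norm !hornerE; ring.
have root_of t z1 z2 :
    l.[t] * (z1 + z2) = - m.[t] -> l.[t] * (z1 * z2) = c.[t] ->
    l.[t] * z1 ^+ 2 + m.[t] * z1 + c.[t] = 0.
  by move=> e1 e2; rewrite -e2 -[m.[t]]opprK -e1; ring.
have generic t : (l * ('X - t0%:P)).[t] != 0 -> trace.[t] = 0 /\ norm.[t] = 0.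
  rewrite hornerM hornerXsubC mulf_eq0 negb_or subr_eq0 => /andP[lt tt0].
  have [z1 [z2 [e1 e2]]] := quadratic_split m.[t] c.[t] lt.
  have v z : l.[t] * z ^+ 2 + m.[t] * z + c.[t] = 0 -> al.[t] + be.[t] * z = 0.
    by move=> r; rewrite -red // vanish // mulr0.
  have v1 := v z1 (root_of _ _ _ e1 e2).
  have v2 : al.[t] + be.[t] * z2 = 0.
    apply: v; apply: (root_of _ z2 z1);
    by [rewrite (addrC z2) | rewrite (mulrC z2)].
  split; first by rewrite -(trE _ _ _ e1) v1 v2 addr0 mulr0.
  by rewrite -(noE _ _ _ e1 e2) v1 mul0r mulr0.
have nz : l * ('X - t0%:P) != 0 by rewrite mulf_neq0 // polyXsubC_eq0.
have tr0 : trace = 0 by apply: (poly_eq0_cofinite nz) => t /generic[].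
have no0 : norm = 0 by apply: (poly_eq0_cofinite nz) => t /generic[].
have e1 : l.[t0] * (z0 + (- m.[t0] / l.[t0] - z0)) = - m.[t0] by field.
have e2 : l.[t0] * (z0 * (- m.[t0] / l.[t0] - z0)) = c.[t0].
  transitivity (- (l.[t0] * z0 ^+ 2 + m.[t0] * z0 + c.[t0]) + c.[t0]).
    by field.
  by rewrite root0 oppr0 add0r.
move: (trE _ _ _ e1) (noE _ _ _ e1 e2).
rewrite tr0 no0 horner0 => /eqP.
rewrite mulf_eq0 (negbTE lt0) /= addr_eq0 => /eqP a1.
move=> /eqP; rewrite mulf_eq0 (negbTE lt0) /= mulf_eq0 => vz.
have {vz} : al.[t0] + be.[t0] * z0 = 0.
  by case/orP: vz => /eqP // w; rewrite a1 w oppr0.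
rewrite -red // => /eqP; rewrite mulf_eq0 expf_eq0 (negbTE lt0) andbF /=.
by move/eqP.
Qed.

(** Evaluating a polynomial in n variables along the parametrised surface V is
    evaluating a bivariate polynomial at the parameters. *)
Lemma horner2_mmap n (V : 'I_n -> {poly {poly F}}) (p : {mpoly F[n]}) x y :
  (mmap (fun a => a%:P%:P) V p).[x, y] = p.@[fun i => (V i).[x, y]].
Proof.
rewrite mevalE /mmap !horner_sum; apply: eq_bigr => m _.
rewrite !hornerM !hornerC /mmap1 !horner_prod; congr (_ * _).
by apply: eq_bigr => i _; rewrite !horner_exp.
Qed.

End Quadratic.

(** * The torus map and its inverse *)

Section Families.
Context {F : closedFieldType}.
Implicit Types a : F.

(* Discharges the nonvanishing conditions left by field from the context. *)
Ltac nonzero := repeat (apply/andP; split); by rewrite ?oner_neq0 ?oppr_eq0.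

Lemma coord1_row n (s : seq F) i :
  (i < n.+1)%N -> coord1 (\row_(j < n.+1) s`_j) i.+1 = s`_i.
Proof. by move=> lt_i; rewrite /coord1 mxE inordK. Qed.

Lemma coord1E n (x : 'rV[F]_n.+1) (j : 'I_n.+1) : x 0 j = coord1 x j.+1.
Proof. by rewrite /coord1 /= inord_val. Qed.

Lemma quotient_on_coord1 n (X : set 'rV[F]_n.+1) i :
  quotient_on X (fun x => coord1 x i).
Proof. exact: quotient_on_coord. Qed.

Lemma quotient_on_coord1_lsubmx n (X : set 'rV[F]_(n.+1 + 1)) i :
  quotient_on X (fun z => coord1 (lsubmx z) i).
Proof.
apply: eq_quotient_on (quotient_on_coord X (lshift 1 (inord i.-1))) => z _.
by rewrite /coord1 mxE.
Qed.

Lemma torus_coord1 n (x : 'rV[F]_n.+1) i : torus x -> coord1 x i != 0.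
Proof. by move=> h; exact: h. Qed.

Definition C_equation a (x : 'rV[F]_4) : Prop :=
  - 1 + coord1 x 1 + coord1 x 2 + coord1 x 3 + coord1 x 4
    + a * (coord1 x 1 * coord1 x 2 * coord1 x 3)^-1
    + coord1 x 1 * coord1 x 2 * (coord1 x 4)^-1 = 0.

Definition BB_equations a (y : 'rV[F]_5) : Prop :=
  coord1 y 1 + coord1 y 2 + coord1 y 3 + a * coord1 y 4 = 1 /\
  coord1 y 5 + (coord1 y 1 * coord1 y 2 * coord1 y 3 * coord1 y 4 * coord1 y 5)^-1
    = 1.

Lemma member_C a x : member family_C a x <-> torus x /\ C_equation a x.
Proof.
rewrite /member /family_C /= /times_line /= row_mxKl /param row_mxKr.
by rewrite mxE eqxx mulr1n.
Qed.

Lemma member_BB a y : member family_BB a y <-> torus y /\ BB_equations a y.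
Proof.
rewrite /member /family_BB /= /times_line /= row_mxKl /param row_mxKr.
by rewrite mxE eqxx mulr1n.
Qed.

Lemma torus_map_torus (y : 'rV[F]_5) : torus y -> torus (torus_map y).
Proof.
move=> ty j; rewrite mxE.
case: j => [[|[|[|[|?]]]] ?] //=;
by rewrite ?invr_eq0 ?mulf_neq0 ?(torus_coord1 _ ty).
Qed.

Lemma torus_map_C a y :
  torus y -> BB_equations a y -> C_equation a (torus_map y).
Proof.
move=> ty [e1 e2].
rewrite /C_equation !coord1_row //=.
have := (torus_coord1 1 ty, torus_coord1 2 ty, torus_coord1 3 ty,
         torus_coord1 4 ty, torus_coord1 5 ty).
move: e1 e2; move: (coord1 y 1) (coord1 y 2) (coord1 y 3) (coord1 y 4)
  (coord1 y 5) => y1 y2 y3 y4 y5 e1 e2 [[[[n1 n2] n3] n4] n5].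
have X1E : (y2 * y3 * y4 * y5)^-1 = y1 * (1 - y5).
  by rewrite -e2; field; nonzero.
have X4E : (y1 * y3 * y4 * y5)^-1 = y2 * (1 - y5).
  by rewrite -e2; field; nonzero.
have X12E : (y2 * y3 * y4 * y5)^-1 * (y2 * y5) = (y3 * y4)^-1 by field; nonzero.
rewrite X12E.
have -> : ((y3 * y4)^-1 * y3)^-1 = y4 by field; nonzero.
rewrite X1E invrK.
have -> : (y3 * y4)^-1 * (y1 * y3 * y4 * y5) = y1 * y5 by field; nonzero.
transitivity (y1 + y2 + y3 + a * y4 - 1); last by rewrite e1 subrr.
by rewrite X4E; ring.
Qed.

(** Taking the point g x of the torus as a function of an auxiliary variable
    covers both the torus map itself and its product with the affine line. *)
Lemma torus_map_quotient n (X : set 'rV[F]_n) (g : 'rV[F]_n -> 'rV[F]_5) j :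
  (forall x, X x -> torus (g x)) ->
  (forall i, quotient_on X (fun x => coord1 (g x) i)) ->
  quotient_on X (fun x => torus_map (g x) 0 j).
Proof.
move=> tg qg.
have nz i x : X x -> coord1 (g x) i != 0 by move=> /tg /torus_coord1.
have row_entry : quotient_on X (fun x =>
    [:: (coord1 (g x) 2 * coord1 (g x) 3 * coord1 (g x) 4 * coord1 (g x) 5)^-1;
        coord1 (g x) 2 * coord1 (g x) 5;
        coord1 (g x) 3;
        (coord1 (g x) 1 * coord1 (g x) 3 * coord1 (g x) 4 * coord1 (g x) 5)^-1]`_j).
  case: j => [[|[|[|[|?]]]] ?] //=.
  - apply: quotient_onV => [x Xx|]; first by rewrite !mulf_neq0 ?nz.
    by do ![apply: quotient_onM].
  - exact: quotient_onM.
  - apply: quotient_onV => [x Xx|]; first by rewrite !mulf_neq0 ?nz.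
    by do ![apply: quotient_onM].
by apply: eq_quotient_on row_entry => x _; rewrite mxE.
Qed.

(** Recovers Y from X by Y2 = X2 + X4, Y1 Y5 = X1 X2 / X4, X2 = Y2 Y5 and
    X1 X2 X3 = 1 / Y4. *)
Definition torus_map_inv (x : 'rV[F]_4) : 'rV[F]_5 :=
  let X1 := coord1 x 1 in let X2 := coord1 x 2 in
  let X3 := coord1 x 3 in let X4 := coord1 x 4 in
  \row_(j < 5) [:: X1 * (X2 + X4) / X4;
                   X2 + X4;
                   X3;
                   (X1 * X2 * X3)^-1;
                   X2 / (X2 + X4)]`_j.

(** The image of the torus map: X2 + X4 is the coordinate Y2, a unit. *)
Definition C_open a : set 'rV[F]_4 :=
  [set x | member family_C a x /\ coord1 x 2 + coord1 x 4 != 0].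

Lemma torus_mapK a y : member family_BB a y -> torus_map_inv (torus_map y) = y.
Proof.
move=> /member_BB[ty [_ e2]]; apply/rowP => j.
rewrite mxE !coord1_row //= [RHS]coord1E.
have := (torus_coord1 1 ty, torus_coord1 2 ty, torus_coord1 3 ty,
         torus_coord1 4 ty, torus_coord1 5 ty).
case=> [[[[n1 n2] n3] n4] n5].
have X24 : coord1 y 2 * coord1 y 5
   + (coord1 y 1 * coord1 y 3 * coord1 y 4 * coord1 y 5)^-1 = coord1 y 2.
  by rewrite -[RHS]mulr1 -[X in _ = _ * X]e2; field; nonzero.
rewrite X24.
by case: j => [[|[|[|[|[|?]]]]] ?] //=; field; nonzero.
Qed.

Lemma torus_map_invK a x : C_open a x -> torus_map (torus_map_inv x) = x.
Proof.
move=> [/member_C[tx _] n24]; apply/rowP => j.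
rewrite mxE !coord1_row //= [RHS]coord1E.
have := (torus_coord1 1 tx, torus_coord1 2 tx, torus_coord1 3 tx,
         torus_coord1 4 tx).
case=> [[[n1 n2] n3] n4].
by case: j => [[|[|[|[|?]]]] ?] //=; field; nonzero.
Qed.

Lemma torus_map_C_open a y : member family_BB a y -> C_open a (torus_map y).
Proof.
move=> hy; have /member_BB[ty [e1 e2]] := hy; split.
  by apply/member_C; split; [exact: torus_map_torus | exact: torus_map_C].
have := congr1 (fun y => coord1 y 2) (torus_mapK hy).
by rewrite {1}/torus_map_inv coord1_row //= => ->; exact: torus_coord1.
Qed.

Lemma torus_map_inv_BB a x : C_open a x -> member family_BB a (torus_map_inv x).
Proof.
move=> [/member_C[tx eC] n24]; apply/member_BB.
have := (torus_coord1 1 tx, torus_coord1 2 tx, torus_coord1 3 tx,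
         torus_coord1 4 tx).
case=> [[[n1 n2] n3] n4].
split.
  move=> j; rewrite mxE.
  by case: j => [[|[|[|[|[|?]]]]] ?] //=; rewrite ?invr_eq0 ?mulf_neq0 ?invr_eq0.
rewrite /BB_equations !coord1_row //=; split.
  apply/eqP; rewrite -subr_eq0 -[X in _ == X]eC; apply/eqP; field; nonzero.
by field; nonzero.
Qed.

Lemma torus_map_inv_quotient a j :
  quotient_on (C_open a) (fun x => torus_map_inv x 0 j).
Proof.
have q i : quotient_on (C_open a) (fun x => coord1 x i).
  exact: quotient_on_coord1.
have nz i x : C_open a x -> coord1 x i != 0.
  by move=> [/member_C[/torus_coord1]].
have q24 : quotient_on (C_open a) (fun x => coord1 x 2 + coord1 x 4).
  exact: quotient_onD.
suff row_entry : quotient_on (C_open a) (fun x =>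
    [:: coord1 x 1 * (coord1 x 2 + coord1 x 4) / coord1 x 4;
        coord1 x 2 + coord1 x 4;
        coord1 x 3;
        (coord1 x 1 * coord1 x 2 * coord1 x 3)^-1;
        coord1 x 2 / (coord1 x 2 + coord1 x 4)]`_j).
  by apply: eq_quotient_on row_entry => x _; rewrite mxE.
case: j => [[|[|[|[|[|?]]]]] ?] //=.
- by apply: quotient_onM; [exact: quotient_onM | apply: quotient_onV => // x /nz].
- apply: quotient_onV => [x Vx|]; first by rewrite !mulf_neq0 ?(nz _ _ Vx).
  by apply: quotient_onM => //; exact: quotient_onM.
- by apply: quotient_onM => //; apply: quotient_onV => // x [].
Qed.

Lemma C_open_open a : open_in (member family_C a) (C_open a).
Proof.
exists [set x | coord1 x 2 + coord1 x 4 = 0].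
  exists [set 'X_(inord 1) + 'X_(inord 3)]; apply/seteqP; split=> x /=.
    by move=> e _ ->; rewrite mevalD !mevalXU.
  by move/(_ _ erefl); rewrite mevalD !mevalXU.
by apply/seteqP; split=> x /= [hx /eqP].
Qed.

(** * Density of the image *)

(** The quadratic equation linking X2 and X3 when X1 and X4 are fixed joins each
    point with X2 + X4 = 0 to points where X2 + X4 is nonzero. *)
Lemma vanish_on_C a (p : {mpoly F[4]}) :
  (forall x, C_open a x -> p.@[x 0] = 0) ->
  forall x, member family_C a x -> p.@[x 0] = 0.
Proof.
move=> vanish x Cx; have /member_C[tx eC] := Cx.
have [s0|s0] := eqVneq (coord1 x 2 + coord1 x 4) 0; last by apply: vanish.
have := (torus_coord1 1 tx, torus_coord1 2 tx, torus_coord1 3 tx,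
         torus_coord1 4 tx).
case=> [[[n1 n2] n3] n4].
pose x1 := coord1 x 1; pose x4 := coord1 x 4.
pose curve t z : 'rV[F]_4 := \row_j [:: x1; t; z; x4]`_j.
have xE : x = curve (coord1 x 2) (coord1 x 3).
  by apply/rowP => j; rewrite mxE coord1E; case: j => [[|[|[|[|?]]]] ?] //=.
pose V (j : 'I_4) : {poly {poly F}} := [:: x1%:P%:P; 'X%:P; 'X; x4%:P%:P]`_j.
have curveE t z (q : {mpoly F[4]}) :
    q.@[curve t z 0] = (mmap (fun b => b%:P%:P) V q).[z, t].
  rewrite horner2_mmap; apply: meval_eq => j; rewrite mxE /V.
  by case: j => [[|[|[|[|?]]]] ?] //=; rewrite !hornerE.
pose m : {poly F} := - ('X * (1 - ('X + x4%:P) * (1 + x1 / x4)%:P)).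
have mE t : m.[t] = - (t * (1 - (t + x4) * (1 + x1 / x4))) by rewrite !hornerE.
(* The factor X3 kills the solutions z = 0 of the quadratic equation, which
   occur when a = 0 and lie outside the torus. *)
have : (p * 'X_(inord 2)).@[x 0] = 0.
  rewrite xE curveE.
  apply: (@vanish_at_quadratic_limit _ 'X m (a / x1)%:P).
  - by rewrite hornerX.
  - move=> t z tx2.
    rewrite hornerX hornerC mE -curveE mevalM mevalXU => t0 quad.
    have -> : curve t z 0 (inord 2) = z by rewrite mxE inordK.
    have [->|z0] := eqVneq z 0; first by rewrite mulr0.
    rewrite vanish ?mul0r //; split; last first.
      rewrite !coord1_row //=; apply: contraNneq tx2 => e.
      by rewrite -(addIr x4 (etrans e (esym s0))).
    apply/member_C; split.
      by move=> j; rewrite mxE; case: j => [[|[|[|[|?]]]] ?] //=.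
    rewrite /C_equation !coord1_row //=.
    apply: (mulfI (mulf_neq0 t0 z0)); rewrite mulr0 -quad.
    by field; nonzero.
  - rewrite hornerX hornerC mE s0 mul0r subr0.
    have e : coord1 x 2 = - x4 by apply/eqP; rewrite -addr_eq0 s0.
    rewrite -[RHS](mulr0 (coord1 x 2 * coord1 x 3)) -eC -/x1 -/x4 e.
    by field; nonzero.
rewrite mevalM mevalXU => /eqP; rewrite mulf_eq0 (negbTE (tx _)) orbF.
by move/eqP.
Qed.

Lemma C_open_dense a : dense_in (member family_C a) (C_open a).
Proof.
move=> O [Z [E ->] ->] [x [Cx nZx]]; apply: contrapT => disj.
apply: nZx => p Ep.
apply: vanish_on_C Cx => x' Vx'; apply: contrapT => px'; apply: disj.
by exists x'; split=> //; split; [case: Vx' | move=> /(_ p Ep)].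
Qed.

(** * Birationality *)

Lemma torus_map_isomorphism a :
  isomorphism (member family_BB a) (C_open a) torus_map.
Proof.
split.
  split=> [y|j]; first exact: torus_map_C_open.
  apply: quotient_on_regular; apply: (torus_map_quotient (g := id)).
    by move=> y /member_BB[].
  exact: quotient_on_coord1.
exists torus_map_inv; split.
- split=> [x|j]; first exact: torus_map_inv_BB.
  by apply: quotient_on_regular; exact: torus_map_inv_quotient.
- exact: torus_mapK.
- exact: torus_map_invK.
Qed.

Lemma torus_map_birational a :
  birational_morphism (member family_BB a) (member family_C a) torus_map.
Proof.
have [[maps reg] inv] := torus_map_isomorphism a; split.
  by split=> // y /maps[].
exists (member family_BB a), (C_open a); split; [| |exact: C_open_open|
  exact: C_open_dense|exact: torus_map_isomorphism].
- exact: open_in_self.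
- by move=> O [Z _ ->] [y [By nZy]]; exists y; split.
Qed.

Lemma times_id_torus_map_morphism :
  morphism (times_line (torus (F := F) (n := 5)))
           (times_line (torus (F := F) (n := 4))) (times_id torus_map).
Proof.
split=> [z|j].
  by rewrite /times_line /times_id /= row_mxKl; exact: torus_map_torus.
apply: quotient_on_regular.
case: (split_ordP j) => i ->.
  have := @torus_map_quotient _ (times_line (@torus F 5)) lsubmx i.
  move=> /(_ (fun _ => id) (quotient_on_coord1_lsubmx _)).
  by apply: eq_quotient_on => z _; rewrite row_mxEl.
apply: eq_quotient_on (quotient_on_coord _ (rshift 5 i)) => z _.
by rewrite row_mxEr mxE.
Qed.

Lemma times_id_torus_map_family z :
  family_BB (F := F) z -> family_C (times_id torus_map z).
Proof.
move=> [tz e].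
rewrite /family_C /times_line /times_id /= /param row_mxKl row_mxKr.
by split; [exact: torus_map_torus | exact: torus_map_C].
Qed.

End Families.

Theorem theorem4p1 (R : realType) :
  [/\ morphism (times_line (torus (F := R[i]) (n := 5)))
               (times_line (torus (F := R[i]) (n := 4)))
               (times_id torus_map),
      forall z : 'rV[R[i]]_(5 + 1),
        family_BB z -> family_C (times_id torus_map z),
      forall z : 'rV[R[i]]_(5 + 1),
        family_BB z -> param (times_id torus_map z) = param z &
      forall a : R[i],
        birational_morphism (member family_BB a) (member family_C a) torus_map].
Proof.
split.
- exact: times_id_torus_map_morphism.
- exact: times_id_torus_map_family.
- by move=> z _; rewrite /param row_mxKr.
- exact: torus_map_birational.
Qed.
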